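(* Let $\pi_\nu$ be the quasi-regular representation on $L^2(B,\nu)$ associated to the action of $G$ on $(B,\nu)$. Assume there is a family $\mathcal F$ of bounded Borel functions $f:B\to\mathbb C$, dense in $L^2(B,\nu)$ and containing $\mathbb 1_B$, such that for each $f\in\mathcal F$ there is a sequence $(E_n,e_n)_{n\in\mathbb N}$ (possibly depending on $f$) of relatively compact Borel subsets $E_n\subset G$ of non-zero Haar measure and Borel maps $e_n:E_n\to B$ such that $\pi_\nu$ is ergodic relative to $(E_n,e_n)$ and $f$. Then $\pi_\nu$ is irreducible.
   Context: $G$ is a locally compact second-countable group with left Haar measure $dg$ and $\mathrm{vol}(E)=\int_G\mathbb 1_E\,dg$; $B$ is a second-countable topological space with a Borel probability measure $\nu$; $G$ acts continuously on $B$, preserving $\nu$-null sets; and for every relatively compact open $U\subset G$, $\sup_{g\in U}\|\frac{dg_*\nu}{d\nu}\|_{L^\infty(B,\nu)}<\infty$. The quasi-regular representation is $(\pi_\nu(g)\varphi)(b)=\varphi(g^{-1}b)\big(\frac{dg_*\nu}{d\nu}(b)\big)^{1/2}$ on $L^2(B,\nu)$, $\langle\varphi,\psi\rangle=\int_B\varphi\overline\psi\,d\nu$, and $\Xi(g)=\langle\pi_\nu(g)\mathbb 1_B,\mathbb 1_B\rangle$. $\pi_\nu$ is ergodic relative to $(E_n,e_n)$ and the bounded Borel function $f$ if, for all $\varphi,\psi\in L^2(B,\nu)$, $$\lim_{n\to\infty}\frac1{\mathrm{vol}(E_n)}\int_{E_n}f(e_n(g))\frac{\langle\pi_\nu(g)\varphi,\psi\rangle}{\Xi(g)}\,dg=\langle\varphi,\mathbb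 1_B\rangle\langle f,\psi\rangle .$$ *)

(* Defs.v *)
From HB Require Import structures.
From mathcomp Require Import all_boot all_order all_algebra.
From mathcomp Require Import all_classical all_reals all_analysis.
From mathcomp Require Import complex.

Set Implicit Arguments.
Unset Strict Implicit.
Unset Printing Implicit Defensive.
Import Order.TTheory GRing.Theory Num.Theory.
Import numFieldNormedType.Exports.

Local Open Scope classical_set_scope.
Local Open Scope ring_scope.
Local Open Scope complex_scope.
Local Open Scope charge_scope.

HB.mixin Record isTopologicalGroup G & PointedTopological G & Group G := {
  mulg_continuous : continuous (fun xy : G * G => (xy.1 * xy.2)%g) ;
  invg_continuous : continuous (fun x : G => (x^-1)%g) ;
}.

(* The distinguished point of the underlying pointed type is arbitrary; it is
   only there because measurable types of the library are pointed. *)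
#[short(type="topologicalGroupType")]
HB.structure Definition TopologicalGroup :=
  {G of PointedTopological G & Group G & isTopologicalGroup G}.

Notation Borel T := (g_sigma_algebraType (@open T)).

Section haar.
Context {R : realType} {G : topologicalGroupType}.
Variable mu : {measure set (Borel G) -> \bar R}.

(* Regularity is not required: it is automatic on a locally compact
   second-countable group.  The hypothesis [measurable K] is automatic when [G]
   is Hausdorff. *)
Definition left_haar_measure :=
  [/\ forall (g : G) (A : set (Borel G)), measurable A ->
        mu [set (g * x)%g | x in (A : set G)] = mu A,
      forall K : set (Borel G), compact (K : set G) -> measurable K ->
        (mu K < +oo)%E
    & mu [set: Borel G] != 0%E].

Definition vol (E : set (Borel G)) : \bar R :=
  (\int[mu]_(g in [set: Borel G]) (\1_E g)%:E)%E.

End haar.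

Record continuous_action (G : topologicalGroupType) (B : topologicalType) := {
  action_fun :> G -> B -> B ;
  action1 : forall b, action_fun 1%g b = b ;
  actionM : forall g h b, action_fun (g * h)%g b = action_fun g (action_fun h b) ;
  action_continuous : continuous (fun gb : G * B => action_fun gb.1 gb.2) }.

Section complex_functions.
Context {R : realType} {d : measure_display} {T : measurableType d}.
Variable mu : {measure set T -> \bar R}.
Implicit Types (f phi psi : T -> R[i]) (V : set (T -> R[i])).

Definition cmeasurable f :=
  measurable_fun [set: T] (fun x => complex.Re (f x)) /\
  measurable_fun [set: T] (fun x => complex.Im (f x)).

Definition cintegral (D : set T) f : R[i] :=
  (\int[mu]_(x in D) complex.Re (f x)) +i* (\int[mu]_(x in D) complex.Im (f x)).

Definition norm2 f : \bar R := ('N[mu]_2%:E[EFin \o (@Normc.normc R \o f)])%E.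

(* Elements of the Hilbert space [L^2] are represented by square-integrable
   functions; equality in the Hilbert space is equality almost everywhere. *)
Definition L2 : set (T -> R[i]) :=
  [set f | cmeasurable f /\ (norm2 f < +oo)%E].

Definition inner phi psi : R[i] :=
  cintegral [set: T] (fun x => phi x * conjc (psi x)).

Definition L2_closure V : set (T -> R[i]) :=
  [set phi | L2 phi /\ forall eps : R, 0 < eps ->
     exists2 psi, V psi & (norm2 (fun x => phi x - psi x)%R < eps%:E)%E].

(* Such a [V] is saturated for equality almost everywhere, because it contains
   its own closure; so these sets correspond exactly to the closed subspaces
   of the space of classes. *)
Definition closed_subspace V :=
  [/\ V `<=` L2, V (fun=> 0),
      forall (a : R[i]) phi psi, V phi -> V psi -> V (fun x => a * phi x + psi x)
    & L2_closure V `<=` V].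

Definition zero_L2 : set (T -> R[i]) :=
  [set phi | L2 phi /\ {ae mu, forall x, phi x = 0}].

Definition dense_in_L2 V := V `<=` L2 /\ L2 `<=` L2_closure V.

Definition irreducible {G : Type} (pi : G -> (T -> R[i]) -> (T -> R[i])) :=
  forall V, closed_subspace V ->
    (forall (g : G) phi, V phi -> V (pi g phi)) ->
    V = zero_L2 \/ V = L2.

End complex_functions.

Section quasi_regular.
Context {R : realType} {G : topologicalGroupType} {B : ptopologicalType}.
Variables (nu : probability (Borel B) R) (a : continuous_action G B).

Lemma continuous_action_section (g : G) : continuous (a g).
Proof.
move=> b; rewrite /continuous_at.
apply: (@continuous_comp _ _ _ (fun x : B => (g, x))
  (fun gb : G * B => a gb.1 gb.2)).
  by apply: cvg_pair => /=; [exact: cvg_cst|exact: cvg_id].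
exact: action_continuous.
Qed.

Definition action_map (g : G) : Borel B -> Borel B := a g.

Lemma measurable_action_map (g : G) :
  measurable_fun [set: Borel B] (action_map g).
Proof.
refine (@measurability _ _ (Borel B) (Borel B) [set: B] (action_map g)
  (@open B) erefl _).
move=> _ [U oU <-]; rewrite setTI; apply: sub_sigma_algebra.
by move/continuousP: (@continuous_action_section g); exact.
Qed.

HB.instance Definition _ (g : G) :=
  @isMeasurableFun.Build _ _ (Borel B) (Borel B) (action_map g)
    (measurable_action_map g).

(* [g_* nu], that is [A |-> nu (g^-1 A)]. *)
Definition translate (g : G) : probability (Borel B) R :=
  distribution nu (action_map g).

Definition translate_density (g : G) : Borel B -> \bar R :=
  ('d (charge_of_finite_measure (translate g)) '/d nu).

Definition quasi_invariant := forall g : G, translate g `<< nu.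

Definition locally_bounded_density :=
  forall U : set G, open U -> precompact U ->
    (ereal_sup [set ('N[nu]_+oo[translate_density g])%E | g in U] < +oo)%E.

Definition quasi_regular (g : G) (phi : Borel B -> R[i]) : Borel B -> R[i] :=
  fun b => phi (action_map (g^-1)%g b) * (Num.sqrt (fine (translate_density g b)))%:C.

Definition one_B : Borel B -> R[i] := fun=> 1.

Definition Xi (g : G) : R[i] := inner nu (quasi_regular g one_B) one_B.

Definition bounded_borel (f : Borel B -> R[i]) :=
  cmeasurable f /\ exists M : R, forall b, Normc.normc (f b) <= M.

Variable mu : {measure set (Borel G) -> \bar R}.

(* A Borel map [E -> B] is given by a total map, only used on [E]. *)
Definition averaging_data (E : nat -> set (Borel G))
    (e : nat -> Borel G -> Borel B) :=
  forall n, [/\ measurable (E n), precompact (E n : set G), vol mu (E n) != 0%E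
              & measurable_fun (E n) (e n)].

Definition ergodic_relative (E : nat -> set (Borel G))
    (e : nat -> Borel G -> Borel B) (f : Borel B -> R[i]) :=
  forall phi psi, L2 nu phi -> L2 nu psi ->
    (fun n => ((fine (vol mu (E n)))^-1)%:C *
       cintegral mu (E n) (fun g =>
         f (e n g) * (inner nu (quasi_regular g phi) psi / Xi g)) : R[i]^o)
    @ \oo --> (inner nu phi one_B * inner nu f psi : R[i]^o).

End quasi_regular.

(* Main.v *)
Require Import Defs.
From HB Require Import structures.
From mathcomp Require Import all_boot all_order all_algebra.
From mathcomp Require Import all_classical all_reals all_analysis.
From mathcomp Require Import complex.
From mathcomp Require Import measurable_realfun ring lra.

Set Implicit Arguments.
Unset Strict Implicit.
Unset Printing Implicit Defensive.
Import Order.TTheory GRing.Theory Num.Theory.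
Import numFieldNormedType.Exports.

Local Open Scope classical_set_scope.
Local Open Scope ring_scope.

(* Let [V] be a closed invariant subspace.  If some [phi] in [V] is not
   orthogonal to [1], then for [psi] orthogonal to [V] all the coefficients
   [<pi(g) phi, psi>] vanish, so the ergodic averages vanish and their limit
   [<phi, 1> <f, psi>] is zero for every [f] in [F]; by density [psi = 0], hence
   [V] is everything.  If [V] is orthogonal to [1], then for [psi] in [V] the
   coefficients [<pi(g) 1, psi> = <1, pi(g^-1) psi>] vanish, and the same
   argument with [phi = 1] gives [psi = 0].
   The orthogonal projection onto [V] rests on the completeness of [L^2], and
   the adjoint relation on the cocycle identity
   [rho_{g^-1}(g^-1 b) rho_g(b) = 1] for the densities. *)

(** * The real Hilbert space structure of complex [L^2] *)

Section complex_square.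
Context {R : rcfType}.
Implicit Types (z w : R[i]) (t : R).

Definition sqmod z : R := complex.Re z ^+ 2 + complex.Im z ^+ 2.

(** The Euclidean scalar product of the plane. The Hilbert space arguments run on this real form;
    [Im_mulJ] recovers the imaginary part of the Hermitian one. *)
Definition rdotp z w : R :=
  complex.Re z * complex.Re w + complex.Im z * complex.Im w.

Lemma sqmod_ge0 z : 0 <= sqmod z.
Proof. by rewrite addr_ge0// sqr_ge0. Qed.

Lemma normc_sqr z : Normc.normc z ^+ 2 = sqmod z.
Proof. by case: z => x y; rewrite sqr_sqrtr// (sqmod_ge0 (x +i* y)%C). Qed.

Lemma rdotpp z : rdotp z z = sqmod z.
Proof. by []. Qed.

Lemma rdotpC z w : rdotp z w = rdotp w z.
Proof. by rewrite /rdotp; ring. Qed.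

Lemma rdotpBl z z' w : rdotp (z - z') w = rdotp z w - rdotp z' w.
Proof. by case: z z' w => [? ?] [? ?] [? ?]; rewrite /rdotp /=; ring. Qed.

Lemma rdotpDl z z' w : rdotp (z + z') w = rdotp z w + rdotp z' w.
Proof. by case: z z' w => [? ?] [? ?] [? ?]; rewrite /rdotp /=; ring. Qed.

Lemma rdotpZl t z w : rdotp (t%:C%C * z) w = t * rdotp z w.
Proof. by case: z w => [? ?] [? ?]; rewrite /rdotp /=; ring. Qed.

(** The constant is not sharp; the bound only has to make products of square-integrable functions
    integrable. *)
Lemma norm_rdotp z w : `|rdotp z w| <= sqmod z + sqmod w.
Proof.
case: z w => [a b] [c d]; rewrite /rdotp /sqmod /= ler_norml.
have := sqr_ge0 (a - c); have := sqr_ge0 (b - d).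
have := sqr_ge0 (a + c); have := sqr_ge0 (b + d).
have := sqr_ge0 a; have := sqr_ge0 b; have := sqr_ge0 c; have := sqr_ge0 d.
by move=> *; apply/andP; split; nra.
Qed.

(** By the parallelogram law the two sides differ by [sqmod (z * w - w')]. *)
Lemma sqmod_linear z w w' :
  sqmod (z * w + w') <= 2 * sqmod z * sqmod w + 2 * sqmod w'.
Proof.
case: z w w' => [a b] [c d] [e f]; rewrite /sqmod /=.
rewrite -subr_ge0 [leRHS](_ : _ =
  (a * c - b * d - e) ^+ 2 + (a * d + b * c - f) ^+ 2); last by ring.
by rewrite addr_ge0// sqr_ge0.
Qed.

Lemma Re_mulJ z w : complex.Re (z * conjc w) = rdotp z w.
Proof. by case: z w => [? ?] [? ?]; rewrite /rdotp /=; ring. Qed.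

Lemma Im_mulJ z w : complex.Im (z * conjc w) = rdotp (- 'i%C * z) w.
Proof. by case: z w => [? ?] [? ?]; rewrite /rdotp /=; ring. Qed.

End complex_square.

Section L2_theory.
Context {R : realType} {d : measure_display} {T : measurableType d}.
Variable mu : {measure set T -> \bar R}.
Implicit Types f g h : T -> R[i].

(** The square of [norm2], kept in the extended reals so that Fatou's lemma and monotonicity apply
    to any measurable function. *)
Definition nsq f : \bar R := (\int[mu]_x (sqmod (f x))%:E)%E.

Definition rdot f g : R := \int[mu]_x (rdotp (f x) (g x)).

Lemma nsq_ge0 f : (0 <= nsq f)%E.
Proof. by apply: integral_ge0 => x _; rewrite lee_fin sqmod_ge0. Qed.

Lemma norm2E f : norm2 mu f = (nsq f `^ (2^-1))%E.
Proof.
rewrite /norm2 unlock; congr (_ `^ _)%E; apply: eq_integral => x _ /=.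
rewrite -normc_sqr ger0_norm ?powR_mulrn //;
  by case: (f x) => ? ?; rewrite sqrtr_ge0.
Qed.

Lemma norm2_lt f (e : R) : 0 < e ->
  (norm2 mu f < e%:E)%E = (nsq f < (e ^+ 2)%:E)%E.
Proof.
move=> e0; rewrite norm2E; move: (nsq_ge0 f).
case: (nsq f) => [r| |] //=; last first.
  by rewrite gt_eqF// ?invr_gt0 ?ltry.
rewrite !lee_fin !lte_fin => r0.
by rewrite powR12_sqrt// -[in RHS](sqr_sqrtr r0) ltr_pXn2r// nnegrE ?sqrtr_ge0 ?ltW.
Qed.

Lemma norm2_lty f : (norm2 mu f < +oo)%E = (nsq f < +oo)%E.
Proof.
rewrite norm2E; move: (nsq_ge0 f).
case: (nsq f) => [r| |] //=; first by rewrite !ltry.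
by rewrite gt_eqF// invr_gt0.
Qed.

Lemma L2P f : L2 mu f <-> cmeasurable f /\ (nsq f < +oo)%E.
Proof. by rewrite /L2 /= norm2_lty. Qed.

Lemma measurable_rdotp f g : cmeasurable f -> cmeasurable g ->
  measurable_fun setT (fun x => rdotp (f x) (g x)).
Proof.
by move=> [? ?] [? ?]; apply: measurable_funD; apply: measurable_funM.
Qed.

Lemma measurable_sqmod f : cmeasurable f ->
  measurable_fun setT (fun x => sqmod (f x)).
Proof. by move=> mf; apply: measurable_rdotp. Qed.

Lemma cmeasurable_linear (c : R[i]) f g : cmeasurable f -> cmeasurable g ->
  cmeasurable (fun x => c * f x + g x).
Proof.
move=> [rf jf] [rg jg]; split.
  rewrite (_ : (fun _ => _) = (fun x => complex.Re c * complex.Re (f x) -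
     complex.Im c * complex.Im (f x) + complex.Re (g x))); last first.
    by apply/funext => x; case: c (f x) (g x) => [? ?] [? ?] [? ?].
  apply: measurable_funD => //; apply: measurable_funB;
    exact: measurable_funM.
rewrite (_ : (fun _ => _) = (fun x => complex.Re c * complex.Im (f x) +
   complex.Im c * complex.Re (f x) + complex.Im (g x))); last first.
  by apply/funext => x; case: c (f x) (g x) => [? ?] [? ?] [? ?].
apply: measurable_funD => //; apply: measurable_funD;
  exact: measurable_funM.
Qed.

Lemma cmeasurableB f g : cmeasurable f -> cmeasurable g ->
  cmeasurable (fun x => f x - g x).
Proof.
move=> mf mg; rewrite (_ : (fun _ => _) = (fun x => (-1) * g x + f x)).
  exact: cmeasurable_linear.
by apply/funext => x; rewrite mulN1r addrC.
Qed.

Lemma L2_linear (c : R[i]) f g : L2 mu f -> L2 mu g ->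
  L2 mu (fun x => c * f x + g x).
Proof.
move=> /L2P[mf foo] /L2P[mg goo]; apply/L2P; split.
  exact: cmeasurable_linear.
have msq h : cmeasurable h -> measurable_fun setT (fun x => (sqmod (h x))%:E).
  by move=> mh; apply/measurable_EFinP; exact: measurable_sqmod.
apply: (@le_lt_trans _ _ (\int[mu]_x ((2 * sqmod c)%:E * (sqmod (f x))%:E +
    2%:E * (sqmod (g x))%:E))%E).
  apply: ge0_le_integral => //.
  - by move=> x _; rewrite lee_fin sqmod_ge0.
  - by apply: msq; exact: cmeasurable_linear.
  - by apply: emeasurable_funD; apply: emeasurable_funM => //; exact: msq.
  - by move=> x _; rewrite -!EFinM -EFinD lee_fin sqmod_linear.
have ? := sqmod_ge0 c.
rewrite ge0_integralD//.
- rewrite !ge0_integralZl//.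
  + by rewrite lte_add_pinfty// lte_mul_pinfty// lee_fin ?mulr_ge0.
  + exact: msq.
  + by move=> x _; rewrite lee_fin sqmod_ge0.
  + exact: msq.
  + by move=> x _; rewrite lee_fin sqmod_ge0.
  + by rewrite lee_fin mulr_ge0.
- by move=> x _; rewrite -EFinM lee_fin !mulr_ge0 ?sqmod_ge0.
- by apply: emeasurable_funM => //; exact: msq.
- by move=> x _; rewrite -EFinM lee_fin !mulr_ge0 ?sqmod_ge0.
- by apply: emeasurable_funM => //; exact: msq.
Qed.

Lemma L2B f g : L2 mu f -> L2 mu g -> L2 mu (fun x => f x - g x).
Proof.
move=> mf mg; rewrite (_ : (fun _ => _) = (fun x => (-1) * g x + f x)).
  exact: L2_linear.
by apply/funext => x; rewrite mulN1r addrC.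
Qed.

Lemma nsq0 : nsq (fun=> 0) = 0%E.
Proof. by rewrite /nsq /sqmod /= expr0n/= addr0 integral0. Qed.

Lemma L2_0 : L2 mu (fun=> 0).
Proof. by apply/L2P; split; [split; exact: measurable_cst|rewrite nsq0]. Qed.

Lemma L2Z (c : R[i]) f : L2 mu f -> L2 mu (fun x => c * f x).
Proof.
move=> Lf; rewrite (_ : (fun _ => _) = (fun x => c * f x + 0)).
  exact: (L2_linear c Lf L2_0).
by apply/funext => x; rewrite addr0.
Qed.

Lemma integrable_rdotp f g : L2 mu f -> L2 mu g ->
  mu.-integrable setT (EFin \o (fun x => rdotp (f x) (g x))).
Proof.
move=> /L2P[mf foo] /L2P[mg goo].
have mfg := measurable_rdotp mf mg.
apply/integrableP; split; first exact/measurable_EFinP.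
apply: (@le_lt_trans _ _
    (\int[mu]_x ((sqmod (f x))%:E + (sqmod (g x))%:E))%E).
  apply: ge0_le_integral => //.
  - by apply/measurable_EFinP; exact: measurableT_comp.
  - by apply: emeasurable_funD; apply/measurable_EFinP; exact: measurable_sqmod.
  - by move=> x _; rewrite -EFinD lee_fin norm_rdotp.
rewrite ge0_integralD//; first by rewrite lte_add_pinfty.
- by move=> x _; rewrite lee_fin sqmod_ge0.
- by apply/measurable_EFinP; exact: measurable_sqmod.
- by move=> x _; rewrite lee_fin sqmod_ge0.
- by apply/measurable_EFinP; exact: measurable_sqmod.
Qed.

Lemma nsqE f : L2 mu f -> nsq f = (rdot f f)%:E.
Proof.
by move=> Lf; rewrite /rdot /Rintegral fineK// integrable_fin_num//;
  exact: integrable_rdotp.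
Qed.

Lemma rdotC f g : rdot f g = rdot g f.
Proof. by apply: eq_Rintegral => x _; rewrite rdotpC. Qed.

Lemma rdotBl f g h : L2 mu f -> L2 mu g -> L2 mu h ->
  rdot (fun x => f x - g x) h = rdot f h - rdot g h.
Proof.
move=> Lf Lg Lh; rewrite -RintegralB//; [|exact: integrable_rdotp..].
by apply: eq_Rintegral => x _; rewrite rdotpBl.
Qed.

Lemma rdotZl (t : R) f g : L2 mu f -> L2 mu g ->
  rdot (fun x => t%:C%C * f x) g = t * rdot f g.
Proof.
move=> Lf Lg; rewrite -RintegralZl//; last exact: integrable_rdotp.
by apply: eq_Rintegral => x _; rewrite rdotpZl.
Qed.

Lemma rdotBr f g h : L2 mu f -> L2 mu g -> L2 mu h ->
  rdot h (fun x => f x - g x) = rdot h f - rdot h g.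
Proof. by move=> *; rewrite rdotC rdotBl// ![rdot _ h]rdotC. Qed.

Lemma rdotZr (t : R) f g : L2 mu f -> L2 mu g ->
  rdot g (fun x => t%:C%C * f x) = t * rdot g f.
Proof. by move=> *; rewrite rdotC rdotZl// rdotC. Qed.

Lemma rdot_ge0 f : 0 <= rdot f f.
Proof. by apply: Rintegral_ge0 => x _; rewrite rdotpp sqmod_ge0. Qed.

(** The imaginary part is the real product after multiplication by $-i$, so a complex subspace can
    be handled with [rdot] alone. *)
Lemma innerE f g :
  inner mu f g = (rdot f g +i* rdot (fun x => - 'i%C * f x) g)%C.
Proof.
rewrite /inner /cintegral; congr (_ +i* _)%C; apply: eq_Rintegral => x _.
  by rewrite Re_mulJ.
by rewrite Im_mulJ.
Qed.

Lemma rdotDl f g h : L2 mu f -> L2 mu g -> L2 mu h ->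
  rdot (fun x => f x + g x) h = rdot f h + rdot g h.
Proof.
move=> Lf Lg Lh; rewrite -RintegralD//; [|exact: integrable_rdotp..].
by apply: eq_Rintegral => x _; rewrite rdotpDl.
Qed.

Lemma L2D f g : L2 mu f -> L2 mu g -> L2 mu (fun x => f x + g x).
Proof.
move=> Lf Lg; rewrite (_ : (fun _ => _) = (fun x => 1 * f x + g x)).
  exact: L2_linear.
by apply/funext => x; rewrite mul1r.
Qed.

Lemma rdot_sqrB f g : L2 mu f -> L2 mu g ->
  rdot (fun x => f x - g x) (fun x => f x - g x) =
  rdot f f - 2 * rdot f g + rdot g g.
Proof.
move=> Lf Lg; have LB := L2B Lf Lg.
by rewrite rdotBl// !rdotBr// (rdotC g f); ring.
Qed.

Lemma rdot_parallelogram f g : L2 mu f -> L2 mu g ->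
  rdot (fun x => f x - g x) (fun x => f x - g x) =
  2 * rdot f f + 2 * rdot g g -
  rdot (fun x => f x + g x) (fun x => f x + g x).
Proof.
move=> Lf Lg; have LD := L2D Lf Lg.
rewrite rdot_sqrB// rdotDl// !(rdotC _ (fun x => f x + g x)) !rdotDl//.
by rewrite (rdotC g f); ring.
Qed.

End L2_theory.

(** * Completeness *)

(** The sequence is its first term plus a telescoping series dominated by a geometric one. *)
Lemma geometric_steps_cvgn (R : realType) (a : nat -> R) (K : R) :
  (forall n, `|a n.+1 - a n| <= K / 2 ^+ n) -> cvgn a.
Proof.
move=> aK.
have -> : a = (fun n => a 0%N + series (telescope a) n).
  by apply/funext => n; rewrite -eq_sum_telescope.
apply: is_cvgD; first exact: is_cvg_cst.
apply: normed_cvg; apply: (@series_le_cvg _ _ (geometric K 2^-1)).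
- by move=> n; exact: normr_ge0.
- by move=> n; rewrite /= exprVn (le_trans _ (aK n)).
- by move=> n; rewrite /= exprVn; exact: aK.
- by apply: is_cvg_geometric_series; rewrite ger0_norm ?invf_lt1 ?ltr1n.
Qed.

Lemma limn_einf_le (R : realType) (u : (\bar R)^nat) (c : \bar R) N :
  (forall m, (N <= m)%N -> (u m <= c)%E) -> (limn_einf u <= c)%E.
Proof.
move=> uc; rewrite limn_einf_lim; apply: lime_le; first exact: is_cvg_einfs.
apply: nearW => n; apply: (@le_trans _ _ (u (maxn n N))); last first.
  by apply: uc; exact: leq_maxr.
by apply: ereal_inf_lbound; exists (maxn n N) => //=; exact: leq_maxl.
Qed.

Lemma cvgn_complex_sqmod (R : realType) (a b : nat -> R) (z : R[i]) :
  cvgn a -> cvgn b ->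
  sqmod (z - (a n +i* b n)%C) @[n --> \oo] -->
  sqmod (z - (limn a +i* limn b)%C).
Proof.
case: z => x y ca cb; rewrite /sqmod /=.
by apply: cvgD; apply: cvgM; apply: cvgB => //; exact: cvg_cst.
Qed.

Lemma sqmod_components (R : realType) (z w : R[i]) (e : R) : 0 <= e ->
  sqmod (z - w) <= e ^+ 2 ->
  `|complex.Re w - complex.Re z| <= e /\ `|complex.Im w - complex.Im z| <= e.
Proof.
move=> e0; case: z w => [x y] [x' y']; rewrite /sqmod /= => h.
split; rewrite -(@ler_pXn2r _ 2)// ?nnegrE// real_normK ?num_real//.
  by apply: le_trans h; rewrite -sqrrN opprB lerDl sqr_ge0.
by apply: le_trans h; rewrite -[leLHS]sqrrN opprB lerDr sqr_ge0.
Qed.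

Section L2_complete.
Context {R : realType} {d : measure_display} {T : measurableType d}.
Variable mu : {measure set T -> \bar R}.

(* [\sum_n 4^n |u_n - u_{n+1}|^2] is integrable, hence finite a.e., so that
   a.e. the steps are O(2^-n); this avoids Minkowski's inequality and works for
   an arbitrary measure. *)
Lemma ae_cvg_of_summable_steps (u : nat -> T -> R[i]) (C : R) :
  (forall n, cmeasurable (u n)) ->
  (forall n, nsq mu (fun x => u n x - u n.+1 x)%R <= (C / 8 ^+ n)%:E)%E ->
  {ae mu, forall x, cvgn (fun n => complex.Re (u n x)) /\
                    cvgn (fun n => complex.Im (u n x))}.
Proof.
move=> mu_ uC.
have C0 : 0 <= C.
  have := uC 0%N; rewrite expr0 divr1; move/(le_trans (nsq_ge0 _ _)).
  by rewrite lee_fin.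
pose s n x : \bar R := (4 ^+ n * sqmod (u n x - u n.+1 x))%:E.
have s0 n x : (0 <= s n x)%E.
  by rewrite lee_fin mulr_ge0 ?exprn_ge0 ?sqmod_ge0.
have msq n : measurable_fun setT (fun x => (sqmod (u n x - u n.+1 x))%:E).
  by apply/measurable_EFinP; apply: measurable_sqmod; exact: cmeasurableB.
have ms n : measurable_fun setT (s n).
  apply/measurable_EFinP; apply: measurable_funM => //.
  by apply: measurable_sqmod; exact: cmeasurableB.
have iS : mu.-integrable setT (fun x => \sum_(n <oo) s n x)%E.
  apply/integrableP; split.
    by apply: ge0_emeasurable_sum => // n x _ _; exact: s0.
  under eq_integral do rewrite gee0_abs ?nneseries_ge0//.
  rewrite integral_nneseries//.
  (* The bound is $4^n \cdot C/8^n = C/2^n$, written as $2C/2^{n+1}$ to match the series of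
     [epsilon_trick0]. *)
  apply: (@le_lt_trans _ _
    (\sum_(n <oo) (2 * C / (2 ^ n.+1)%:R)%:E)%E).
    apply: lee_nneseries => n *; first by apply: integral_ge0 => *; exact: s0.
    rewrite /s.
    under eq_integral do rewrite EFinM.
    rewrite ge0_integralZl//; last first.
      by move=> x _; rewrite lee_fin sqmod_ge0.
    apply: (@le_trans _ _ ((4 ^+ n)%:E * (C / 8 ^+ n)%:E)%E).
      by rewrite lee_wpmul2l// ?lee_fin ?exprn_ge0//; exact: uC.
    rewrite -EFinM lee_fin natrX exprS.
    have -> : 8 = 2 * 4 :> R by rewrite -natrM.
    rewrite exprMn le_eqVlt; apply/orP; left; apply/eqP; field.
    by rewrite !expf_neq0.
  apply: le_lt_trans (epsilon_trick0 xpredT _) _; first by rewrite mulr_ge0.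
  exact: ltry.
have := integrable_ae measurableT iS.
apply: filterS => x /(_ I) Sfin.
set K := fine (\sum_(n <oo) s n x)%E in Sfin *.
have K0 : 0 <= K by apply: fine_ge0; exact: nneseries_ge0.
(* Since $K \le (K+1)^2$, using [K + 1] avoids a square root of [K]. *)
have sK n : sqmod (u n x - u n.+1 x) <= ((K + 1) / 2 ^+ n) ^+ 2.
  have : (s n x <= K%:E)%E.
    (* The term of index [n] is the last one of the partial sum with [n.+1] terms. *)
    rewrite fineK//; apply: le_trans (nneseries_lim_ge n.+1 _) => //.
    rewrite big_nat_recr//= leeDr// sume_ge0// => i _; exact: s0.
  rewrite lee_fin => h; rewrite expr_div_n -exprM mulnC exprM.
  rewrite ler_pdivlMr ?exprn_gt0// mulrC -natrX.
  apply: le_trans h _.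
  have : 0 <= K ^+ 2 by exact: sqr_ge0.
  by nra.
split; apply: (@geometric_steps_cvgn _ _ (K + 1)) => n.
  by apply: (sqmod_components _ (sK n)).1; rewrite divr_ge0 ?exprn_ge0 ?addr_ge0.
by apply: (sqmod_components _ (sK n)).2; rewrite divr_ge0 ?exprn_ge0 ?addr_ge0.
Qed.

(* The conclusion is Fatou's lemma: bounds on the distance from any [f] to the
   terms of the sequence pass to the limit. *)
Lemma L2_complete (u : nat -> T -> R[i]) (C : R) :
  (forall n, L2 mu (u n)) ->
  (forall n m, (n <= m)%N ->
     nsq mu (fun x => u n x - u m x)%R <= (C / 8 ^+ n)%:E)%E ->
  exists2 v, L2 mu v & forall f (c : R) N, L2 mu f ->
    (forall m, (N <= m)%N -> nsq mu (fun x => f x - u m x)%R <= c%:E)%E ->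
    (nsq mu (fun x => f x - v x)%R <= c%:E)%E.
Proof.
move=> uL uC.
have mu_ n : cmeasurable (u n) by case/L2P : (uL n).
have ucvg := ae_cvg_of_summable_steps mu_ (fun n => uC n n.+1 (leqnSn n)).
pose a n x := complex.Re (u n x); pose b n x := complex.Im (u n x).
(* An upper limit exists at every point, which makes [v] measurable at once. [fine] sends an
   infinite one to 0, which matters only on a null set. *)
pose v x := (fine (limn_esup (fun n => (a n x)%:E)) +i*
             fine (limn_esup (fun n => (b n x)%:E)))%C.
have mv : cmeasurable v.
  split => /=; apply: measurableT_comp => //;
  apply: (@measurable_fun_limn_esup _ _ _ _ (fun n x => (_ n x)%:E)) => n;
  apply/measurable_EFinP; by case: (mu_ n).
have fat f (c : R) N : L2 mu f ->
    (forall m, (N <= m)%N -> nsq mu (fun x => f x - u m x)%R <= c%:E)%E ->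
    (nsq mu (fun x => f x - v x)%R <= c%:E)%E.
  move=> /L2P[mf _] fc.
  have mg m : measurable_fun setT (fun x => (sqmod (f x - u m x))%:E).
    by apply/measurable_EFinP; apply: measurable_sqmod; exact: cmeasurableB.
  rewrite /nsq (@ae_eq_integral _ _ _ mu setT
    (fun x => limn_einf (fun m => (sqmod (f x - u m x))%:E)))//.
  - apply: le_trans (fatou _ _ _ _) _ => //.
      by move=> n x _; rewrite lee_fin sqmod_ge0.
    exact: limn_einf_le fc.
  - by apply/measurable_EFinP; apply: measurable_sqmod; exact: cmeasurableB.
  (* A lower limit is minus the upper limit of the opposites, so the measurability of upper limits
     applies. *)
  - rewrite (_ : (fun _ => _) =
      (fun x => - limn_esup (fun m => - (sqmod (f x - u m x))%:E))%E).
      apply: measurableT_comp => //.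
      apply: (@measurable_fun_limn_esup _ _ _ _
        (fun m x => - (sqmod (f x - u m x))%:E)%E) => m.
      exact: measurableT_comp.
    apply/funext => x; rewrite -limn_einfN; congr limn_einf.
    by apply/funext => m /=; rewrite opprK.
  - move: ucvg; apply: filterS => x [ca cb] _.
    suff /cvg_limn_einf_sup[-> _] : (sqmod (f x - u m x))%:E @[m --> \oo]
      --> (sqmod (f x - v x))%:E by [].
    apply/fine_cvgP; split; first exact: nearW.
    have lim_fine (w : nat -> R) : cvgn w ->
        fine (limn_esup (EFin \o w)) = limn w.
      move=> cw.
      suff /cvg_limn_einf_sup[_ ->] : EFin \o w @ \oo --> (limn w)%:E by [].
      by apply/fine_cvgP; split; first exact: nearW.
    rewrite /v !lim_fine//.
    have := @cvgn_complex_sqmod _ _ _ (f x) ca cb.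
    rewrite (_ : (fun n => _) = fine \o (fun m => (sqmod (f x - u m x))%:E))//.
    by apply/funext => m /=; case: (u m x).
exists v => //.
(* [fat] bounds the distance from [u 0] to [v]; then [v] is in $L^2$ as [u 0] minus this
   difference. *)
have Lw := fat (u 0%N) (C / 8 ^+ 0) 0%N (uL 0%N) (fun m _ => uC 0%N m (leq0n m)).
rewrite (_ : v = fun x => u 0%N x - (u 0%N x - v x)); last first.
  by apply/funext => x; rewrite opprB addrC subrK.
apply: L2B => //; apply/L2P; split; first by apply: cmeasurableB.
by apply: le_lt_trans Lw _; rewrite ltry.
Qed.

End L2_complete.

(** * Orthogonal projections *)

Lemma exists_geometric_lt (R : realType) (K e : R) : 0 <= K -> 0 < e ->
  exists n, K / 8 ^+ n < e.
Proof.
move=> K0 e0; exists (Num.bound (K / e)).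
rewrite ltr_pdivrMr ?exprn_gt0// mulrC -ltr_pdivrMr//.
apply: lt_le_trans (archi_boundP _) _; first by rewrite divr_ge0// ltW.
by rewrite -natrX ler_nat ltnW// ltn_expl.
Qed.

(** At $t = b/(N+1)$ the expression is $-b^2(N+2)/(N+1)^2$. The shift by 1 keeps the denominator
    positive when $N = 0$. *)
Lemma quadratic_ge0_linear_eq0 (R : realFieldType) (b N : R) : 0 <= N ->
  (forall t, 0 <= - (2 * (t * b)) + t * (t * N)) -> b = 0.
Proof.
move=> N0 h; have N1 : 0 < N + 1 by rewrite ltr_wpDl.
have := h (b / (N + 1)).
have -> : - (2 * (b / (N + 1) * b)) + b / (N + 1) * (b / (N + 1) * N) =
  - (b ^+ 2 * (N + 2)) / (N + 1) ^+ 2 by field; rewrite gt_eqF.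
rewrite pmulr_lge0 ?invr_gt0 ?exprn_gt0// oppr_ge0.
rewrite pmulr_lle0 ?ltr_wpDl// => b0; apply/eqP.
by rewrite -sqrf_eq0 eq_le b0 sqr_ge0.
Qed.

Section closed_subspaces.
Context {R : realType} {d : measure_display} {T : measurableType d}.
Variable mu : {measure set T -> \bar R}.
Implicit Types (f g : T -> R[i]) (V F : set (T -> R[i])).

Lemma nsqB f g : nsq mu (fun x => f x - g x) = nsq mu (fun x => g x - f x).
Proof.
apply: eq_integral => x _; congr EFin; rewrite -opprB /sqmod.
by case: (g x - f x) => ? ? /=; rewrite !sqrrN.
Qed.

Lemma nsq_eq0 f : cmeasurable f ->
  nsq mu f = 0%E <-> {ae mu, forall x, f x = 0}.
Proof.
move=> mf; have mq : measurable_fun setT (fun x => (sqmod (f x))%:E).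
  by apply/measurable_EFinP; exact: measurable_sqmod.
have -> : nsq mu f = (\int[mu]_x `|(sqmod (f x))%:E|)%E.
  by apply: eq_integral => x _; rewrite gee0_abs// lee_fin sqmod_ge0.
rewrite ae_eq_integral_abs//; split; apply: filterS => x.
  move=> /(_ I) [] /eqP; case: (f x) => a b; rewrite /sqmod /=.
  by rewrite paddr_eq0 ?sqr_ge0// !sqrf_eq0 => /andP[/eqP-> /eqP->].
by move=> -> _; rewrite /sqmod /= expr0n/= addr0.
Qed.

Lemma closed_subspace_lin V (c : R[i]) f g : closed_subspace mu V ->
  V f -> V g -> V (fun x => c * f x + g x).
Proof. by case=> _ _ + _; exact. Qed.

Lemma closed_subspaceZ V (c : R[i]) f : closed_subspace mu V ->
  V f -> V (fun x => c * f x).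
Proof.
move=> Vc Vf; rewrite (_ : (fun _ => _) = (fun x => c * f x + 0)).
  by apply: (@closed_subspace_lin V c f (fun=> 0)) => //; case: Vc.
by apply/funext => x; rewrite addr0.
Qed.

Lemma closed_subspace_limit V f (g : nat -> T -> R[i]) (K : R) :
  closed_subspace mu V -> L2 mu f -> (forall n, V (g n)) ->
  (forall n, nsq mu (fun x => g n x - f x)%R <= (K / 8 ^+ n)%:E)%E -> V f.
Proof.
move=> [_ _ _ Vcl] Lf Vg gK; apply: Vcl; split => // e e0.
have K0 : 0 <= K.
  have := gK 0%N; rewrite expr0 divr1; move/(le_trans (nsq_ge0 _ _)).
  by rewrite lee_fin.
have [n nK] := exists_geometric_lt K0 (exprn_gt0 2 e0).
exists (g n) => //; rewrite norm2_lt// nsqB; apply: le_lt_trans (gK n) _.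
by rewrite lte_fin.
Qed.

(** A constant sequence converges at rate [K = 0]: this is the saturation of [V] under equality
    almost everywhere. *)
Lemma closed_subspace_nsq0 V f g : closed_subspace mu V -> L2 mu f -> V g ->
  nsq mu (fun x => f x - g x) = 0%E -> V f.
Proof.
move=> Vc Lf Vg fg0; apply: (@closed_subspace_limit V f (fun=> g) 0) => // n.
by rewrite nsqB fg0 mul0r.
Qed.

Lemma zero_L2_sub V : closed_subspace mu V -> zero_L2 mu `<=` V.
Proof.
move=> Vc f [Lf f0]; apply: (@closed_subspace_nsq0 V f (fun=> 0)) => //.
  by case: Vc.
rewrite (_ : (fun _ => _) = f); last by apply/funext => x; rewrite subr0.
by apply/nsq_eq0 => //; case: Lf.
Qed.

(** If $f \neq 0$, some $g$ in $F$ lies at distance less than $\|f\|$, but orthogonality gives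
    $\|f-g\|^2 = \|f\|^2 + \|g\|^2$. Linearity of $F$ does not enter. *)
Lemma nsq_orth_dense F f : dense_in_L2 mu F -> L2 mu f ->
  (forall g, F g -> inner mu g f = 0) -> nsq mu f = 0%E.
Proof.
move=> [FL2 Fd] Lf Ff; rewrite nsqE//; congr EFin.
apply/eqP; rewrite eq_le rdot_ge0 andbT leNgt; apply/negP => f0.
have [_ /(_ (Num.sqrt (rdot mu f f)))] := Fd _ Lf.
rewrite sqrtr_gt0 => /(_ f0)[g Fg]; have Lg := FL2 _ Fg.
rewrite norm2_lt ?sqrtr_gt0// sqr_sqrtr ?ltW// nsqE; last exact: L2B.
have : rdot mu g f = 0 by have := Ff _ Fg; rewrite innerE => -[].
rewrite lte_fin rdot_sqrB// (rdotC _ f g) => ->.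
by rewrite mulr0 subr0 ltNge lerDl rdot_ge0.
Qed.

(** [V] is stable under multiplication by $-i$, so real orthogonality also kills the imaginary
    part. *)
Lemma rdot_eq0_inner_eq0 V g : closed_subspace mu V ->
  (forall f, V f -> rdot mu f g = 0) -> forall f, V f -> inner mu f g = 0.
Proof.
move=> Vc h f Vf; rewrite innerE !h//; exact: closed_subspaceZ.
Qed.

(** A sequence in [V] minimizing the distance to [f] is Cauchy by the parallelogram law; its limit
    attains the minimum, and the first variation there gives orthogonality. *)
Lemma L2_projection V f : closed_subspace mu V -> L2 mu f ->
  exists2 v, V v & forall w, V w -> inner mu w (fun x => f x - v x) = 0.
Proof.
move=> Vc Lf; have [VL2 V0 _ _] := Vc.
pose q g := rdot mu (fun x => f x - g x) (fun x => f x - g x).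
pose A := [set q g | g in V].
have A0 : lbound A 0 by move=> _ [g _ <-]; exact: rdot_ge0.
have hA : has_inf A by split; [exists (q (fun=> 0)), (fun=> 0)|exists 0].
have qge g : V g -> inf A <= q g.
  by move=> Vg; apply: ge_inf; [exists 0|exists g].
have e8 (n : nat) : 0 < (8 ^+ n)^-1 :> R by rewrite invr_gt0 exprn_gt0.
have /choice[u uP] n : exists g, V g /\ q g < inf A + (8 ^+ n)^-1.
  by have [_ [g Vg <-] ?] := inf_adherent (e8 n) hA; exists g.
have Vu n : V (u n) := (uP n).1.
have Lu n : L2 mu (u n) := VL2 _ (Vu n).
have e8_anti n m : (n <= m)%N -> (8 ^+ m)^-1 <= (8 ^+ n)^-1 :> R.
  by move=> nm; rewrite lef_pV2 ?posrE ?exprn_gt0// ler_eXn2l ?ltr1n.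
(* With $c$ the midpoint, $\|u_n-u_m\|^2 = 2q(u_m) + 2q(u_n) - 4q(c) \le 2(8^{-m} + 8^{-n}) \le 4
   \cdot 8^{-n}$, because $q(c)$ is at least the infimum. *)
have cauchy n m : (n <= m)%N ->
    (nsq mu (fun x => u n x - u m x)%R <= (4 / 8 ^+ n)%:E)%E.
  move=> nm; rewrite nsqE ?lee_fin; last exact: L2B.
  pose p x := f x - u m x; pose r x := f x - u n x.
  have Lp : L2 mu p by exact: L2B.
  have Lr : L2 mu r by exact: L2B.
  rewrite (_ : (fun x => _) = (fun x => p x - r x)); last first.
    by apply/funext => x; rewrite /p /r; ring.
  rewrite rdot_parallelogram//.
  pose c x := (2^-1)%:C%C * u n x + (2^-1)%:C%C * u m x.
  have Vmid : V c.
    by apply: closed_subspace_lin => //; exact: closed_subspaceZ.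
  have half (z : R[i]) : 2%:C%C * ((2^-1)%:C%C * z) = z.
    by rewrite mulrA -rmorphM/= divff// mul1r.
  have Lc : L2 mu (fun x => f x - c x) by apply: L2B => //; exact: VL2.
  rewrite (_ : (fun x => p x + r x) = (fun x => 2%:C%C * (f x - c x))).
    rewrite rdotZl//; last exact: L2Z.
    rewrite rdotZr//.
    have := qge _ Vmid; have := (uP n).2; have := (uP m).2.
    have := e8_anti _ _ nm; rewrite /q -/p -/r.
    move: (rdot _ _ _) (rdot _ _ _) (rdot _ _ _) => *; lra.
  apply/funext => x; rewrite mulrBr mulrDr !half /p /r.
  by rewrite -[2%:C%C]/((1 + 1)%:C%C) rmorphD/= mulrDl mul1r; ring.
have [v Lv vP] := L2_complete Lu cauchy.
have Vv : V v.
  apply: (closed_subspace_limit (g := u) (K := 4)) => // n.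
  by apply: (vP _ _ n) => // m nm; exact: cauchy.
have Lfv : L2 mu (fun x => f x - v x) by exact: L2B.
(* The tail of [u] is within [inf A + e] of [f] in squared distance, and such bounds pass to [v]. *)
have qv : q v <= inf A.
  apply/ler_addgt0Pr => e e0.
  have [n] := exists_geometric_lt ler01 e0; rewrite mul1r => ne.
  rewrite -lee_fin -nsqE//; apply: (vP _ _ n) => // m nm.
  rewrite nsqE ?lee_fin; last exact: L2B.
  apply: ltW; apply: lt_le_trans (uP m).2 _; rewrite lerD2l.
  exact: le_trans (e8_anti _ _ nm) (ltW ne).
exists v => //; apply: rdot_eq0_inner_eq0 => // w Vw.
have Lw := VL2 _ Vw.
apply: (@quadratic_ge0_linear_eq0 _ _ (rdot mu w w) (rdot_ge0 _ _)) => t.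
(* The competitor [t * w + v] is no closer to [f] than [v]; expanding gives the quadratic inequality
   in [t]. *)
have := le_trans qv (qge _ (closed_subspace_lin t%:C%C Vc Vw Vv)).
rewrite /q (_ : (fun x => f x - (_ + _)) =
  (fun x => (f x - v x) - t%:C%C * w x)); last first.
  by apply/funext => x; ring.
have Ltw := L2Z t%:C%C Lw.
rewrite [leRHS]rdot_sqrB// rdotZr// rdotZl// rdotZr// (rdotC _ _ w).
by move=> h; lra.
Qed.

End closed_subspaces.

(** * The quasi-regular representation *)

Section quasi_regular.
Context {R : realType} {G : topologicalGroupType} {B : ptopologicalType}.
Variables (nu : probability (Borel B) R) (a : continuous_action G B).
Hypothesis nu_qi : quasi_invariant nu a.

Local Notation rho g := (translate_density nu a g).
Local Notation act g := (action_map a g).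

Lemma act_invK g : cancel (act g) (act g^-1%g).
Proof. by move=> b; rewrite /action_map -actionM mulVg action1. Qed.

Lemma act_Vinv g : cancel (act g^-1%g) (act g).
Proof. by move=> b; rewrite /action_map -actionM mulgV action1. Qed.

Lemma measurable_density g : measurable_fun setT (rho g).
Proof.
by apply: measurable_int; apply: Radon_Nikodym_integrable; exact: nu_qi.
Qed.

Lemma density_fin_num g b : rho g b \is a fin_num.
Proof. by apply: Radon_Nikodym_fin_num; exact: nu_qi. Qed.

(** The derivative is that of a charge, so its sign is obtained by comparison with the nonnegative
    derivative of the measure. *)
Lemma density_ge0 g : {ae nu, forall b, (0 <= rho g b)%E}.
Proof.
have := ae_eq_Radon_Nikodym_SigmaFinite (nu_qi g) measurableT.
apply: filterS => b /(_ I); rewrite /translate_density => <-.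
by apply: Radon_Nikodym_SigmaFinite.f_ge0; exact: nu_qi.
Qed.

Lemma integrable_translate g (f : Borel B -> \bar R) :
  measurable_fun setT f -> nu.-integrable setT (f \o act g) ->
  (translate nu a g).-integrable setT f.
Proof.
move=> mf i; apply: integrable_pushforward => //.
Qed.

(** Both sides are the integral of [f] against $g_*\nu$, by the density and by the push-forward. *)
Lemma integral_translate g (f : Borel B -> \bar R) :
  measurable_fun setT f -> nu.-integrable setT (f \o act g) ->
  (\int[nu]_b (f b * rho g b) = \int[nu]_b f (act g b))%E.
Proof.
move=> mf i.
rewrite Radon_Nikodym_change_of_variables//; last exact: integrable_translate.
  by rewrite integral_distribution.
exact: nu_qi.
Qed.

(** For every measurable $E$, changing variables twice gives $\int_E
    \rho_{g^{-1}}(g^{-1}b)\rho_g(b)\,d\nu = \int_{g^{-1}E} \rho_{g^{-1}}\,d\nu = \nu(E)$, so the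
    integrand is 1 almost everywhere. *)
Lemma density_cocycle g :
  {ae nu, forall b, (rho g^-1%g (act g^-1%g b) * rho g b = 1)%E}.
Proof.
pose f b := rho g^-1%g (act g^-1%g b).
have mf : measurable_fun setT f.
  by apply: measurableT_comp => //; exact: measurable_density.
have fE : f \o act g = rho g^-1%g.
  by apply/funext => b; rewrite /f /= act_invK.
have intf : (translate nu a g).-integrable setT f.
  apply: integrable_translate => //; rewrite fE.
  by apply: Radon_Nikodym_integrable; exact: nu_qi.
suff : ae_eq nu setT (cst 1%E) (fun b => f b * rho g b)%E.
  by apply: filterS => b /(_ I) /esym.
apply: integral_ae_eq => //.
- exact: finite_measure_integrable_cst.
- by apply: emeasurable_funM => //; exact: measurable_density.
- move=> E _ mE; rewrite integral_cst// mul1e.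
  rewrite Radon_Nikodym_change_of_variables//; first last.
  + exact: integrableS intf.
  + exact: nu_qi.
  rewrite [RHS]integral_pushforward//; last first.
    rewrite fE.
    apply: (integrableS measurableT) => //.
      by rewrite -[X in measurable X]setTI; exact: measurable_action_map.
    by apply: Radon_Nikodym_integrable; exact: nu_qi.
  rewrite fE -Radon_Nikodym_integral//; last first.
  + by rewrite -[X in measurable X]setTI; exact: measurable_action_map.
  + exact: nu_qi.
  rewrite /= /charge_of_finite_measure /= /translate /distribution /pushforward /=.
  congr (nu _); apply/seteqP; split => b /=; by rewrite act_Vinv.
Qed.

Definition half_density g (b : Borel B) : R := Num.sqrt (fine (rho g b)).

Lemma measurable_half_density g : measurable_fun setT (half_density g).
Proof.
apply: measurableT_comp; first exact: continuous_measurable_fun (@sqrt_continuous R).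
by apply: measurableT_comp => //; exact: measurable_density.
Qed.

Lemma half_density_cocycle g :
  {ae nu, forall b, half_density g^-1%g (act g^-1%g b) * fine (rho g b) =
                    half_density g b}.
Proof.
have := density_cocycle g; have := density_ge0 g.
apply: filterS2 => b.
rewrite /half_density -(fineK (density_fin_num g b)).
rewrite -(fineK (density_fin_num g^-1%g _)) /= lee_fin.
set x := fine _; set y := fine _ => x0 [yx].
(* The sign of [y], a density at a translated point, is read off from [y * x = 1] and [0 <= x],
   without moving a null set. *)
have y0 : 0 <= y.
  rewrite leNgt; apply/negP => y0.
  have : y * x <= 0 by rewrite nmulr_rle0.
  by rewrite yx ler10.
rewrite -{1}(sqr_sqrtr x0) expr2 mulrA -sqrtrM// yx sqrtr1 mul1r.
by [].
Qed.

(** Change variables in $k(b) = h(b)\rho_{g^{-1}}(g^{-1}b)^{1/2}$: by the cocycle identity $k\rho_g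
    = h\rho_g^{1/2}$ almost everywhere. *)
Lemma Rintegral_half_density g (h : Borel B -> R) :
  measurable_fun setT h ->
  nu.-integrable setT (EFin \o (fun b => h (act g b) * half_density g^-1%g b)) ->
  \int[nu]_b (h b * half_density g b) =
  \int[nu]_b (h (act g b) * half_density g^-1%g b).
Proof.
move=> mh ih; pose k b := h b * half_density g^-1%g (act g^-1%g b).
have mk : measurable_fun setT k.
  apply: measurable_funM => //; apply: measurableT_comp => //.
  exact: measurable_half_density.
have kE b : k (act g b) = h (act g b) * half_density g^-1%g b.
  by rewrite /k act_invK.
rewrite /Rintegral; congr fine.
under [RHS]eq_integral do rewrite -kE.
have := @integral_translate g (EFin \o k); rewrite /= => <-//; last 2 first.
- exact/measurable_EFinP.
- by apply: eq_integrable ih => // b _ /=; rewrite kE.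
apply: ae_eq_integral => //.
- apply/measurable_EFinP; apply: measurable_funM => //.
  exact: measurable_half_density.
- apply: emeasurable_funM; first exact/measurable_EFinP.
  exact: measurable_density.
- have := half_density_cocycle g; apply: filterS => b hb _.
  by rewrite -(fineK (density_fin_num g b)) -EFinM /k -mulrA hb.
Qed.

Lemma L2_one : L2 nu (@one_B R B).
Proof.
apply/L2P; split; first by split; exact: measurable_cst.
rewrite /nsq /one_B /sqmod /= expr1n expr0n/= addr0.
rewrite integral_cst// mul1e. by apply: le_lt_trans (ltry 1); rewrite -(probability_setT nu).
Qed.

Lemma inner_one_one : inner nu (@one_B R B) (@one_B R B) = 1.
Proof.
rewrite innerE /rdot /rdotp /one_B /=.
rewrite !Rintegral_cst// (congr1 fine (probability_setT nu)) /=.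
by apply/eqP; rewrite eq_complex /=; apply/andP; split; apply/eqP; ring.
Qed.

(** Pairing with the constant 1, which is in $L^2$ as $\nu$ is finite, turns square-integrability
    into integrability. *)
Lemma integrable_Re (f : Borel B -> R[i]) : L2 nu f ->
  nu.-integrable setT (EFin \o (fun b => complex.Re (f b))).
Proof.
move=> Lf; apply: eq_integrable (integrable_rdotp Lf L2_one) => // b _.
by rewrite /rdotp /one_B /= mulr1 mulr0 addr0.
Qed.

Lemma integrable_Im (f : Borel B -> R[i]) : L2 nu f ->
  nu.-integrable setT (EFin \o (fun b => complex.Im (f b))).
Proof.
move=> Lf; have := integrable_Re (L2Z (- 'i%C) Lf).
apply: eq_integrable => // b _ /=; congr EFin.
by case: (f b) => ? ? /=; ring.
Qed.

(** The relation $\pi(g)^* = \pi(g^{-1})$ tested on the constant 1, one component at a time.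
    Square-integrability of the translate supplies the integrability for the change of variables. *)
Lemma inner_quasi_regular_one g (psi : Borel B -> R[i]) : L2 nu psi ->
  L2 nu (quasi_regular nu a g^-1%g psi) ->
  inner nu (quasi_regular nu a g (@one_B R B)) psi =
  conjc (inner nu (quasi_regular nu a g^-1%g psi) (@one_B R B)).
Proof.
move=> Lpsi Lgpsi.
have [[mre mim] _] := Lpsi.
have Re_pi b : complex.Re (quasi_regular nu a g^-1%g psi b) =
    complex.Re (psi (act g b)) * half_density g^-1%g b.
  rewrite /quasi_regular /half_density invgK.
  by case: (psi _) => ? ? /=; ring.
have Im_pi b : complex.Im (quasi_regular nu a g^-1%g psi b) =
    complex.Im (psi (act g b)) * half_density g^-1%g b.
  rewrite /quasi_regular /half_density invgK.
  by case: (psi _) => ? ? /=; ring.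
have := integrable_Re Lgpsi; under eq_fun do rewrite Re_pi.
move=> /(Rintegral_half_density mre) reE.
(* The sign comes from [psi] being conjugated in the second slot. *)
have mNim : measurable_fun setT (fun b => - complex.Im (psi b)).
  exact: measurableT_comp.
have intI := integrable_Im Lgpsi.
have imE := Rintegral_half_density (g := g) mNim.
rewrite /inner /cintegral /=; apply/eqP; rewrite eq_complex /=.
apply/andP; split; apply/eqP.
  transitivity (\int[nu]_b (complex.Re (psi b) * half_density g b)).
    apply: eq_Rintegral => b _; rewrite /quasi_regular /half_density /one_B.
    by case: (psi b) => ? ? /=; ring.
  rewrite reE; apply: eq_Rintegral => b _; rewrite -Re_pi /one_B.
  by case: (quasi_regular _ _ _ _ _) => ? ? /=; ring.
transitivity (\int[nu]_b ((- complex.Im (psi b)) * half_density g b)).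
  apply: eq_Rintegral => b _; rewrite /quasi_regular /half_density /one_B.
  by case: (psi b) => ? ? /=; ring.
rewrite imE; last first.
  apply: eq_integrable (integrableN intI) => // b _ /=.
  by rewrite Im_pi mulNr.
transitivity (- \int[nu]_b complex.Im (quasi_regular nu a g^-1%g psi b)).
  rewrite -mulN1r -RintegralZl//.
  by apply: eq_Rintegral => b _; rewrite Im_pi; ring.
congr (- _); apply: eq_Rintegral => b _; rewrite /one_B.
by case: (quasi_regular _ _ _ _ _) => ? ? /=; ring.
Qed.

End quasi_regular.

(** * Ergodic averages and irreducibility *)

Section ergodic.
Context {R : realType} {G : topologicalGroupType} {B : ptopologicalType}.
Variables (nu : probability (Borel B) R) (a : continuous_action G B).
Variable mu : {measure set (Borel G) -> \bar R}.

(** Every average is 0, so by uniqueness of limits the product $\langle\varphi,1\rangle\langle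
    f,\psi\rangle$ is 0, and its first factor cancels. *)
Lemma ergodic_orthogonal E e (f phi psi : Borel B -> R[i]) :
  ergodic_relative nu a mu E e f -> L2 nu phi -> L2 nu psi ->
  (forall g, inner nu (quasi_regular nu a g phi) psi = 0) ->
  inner nu phi (@one_B R B) != 0 -> inner nu f psi = 0.
Proof.
move=> erg Lphi Lpsi orth phi1; apply: (mulfI phi1); rewrite mulr0.
have := erg _ _ Lphi Lpsi.
rewrite (_ : (fun n => _) = cst 0); last first.
  apply/funext => n /=.
  have -> : (fun g => f (e n g) *
      (inner nu (quasi_regular nu a g phi) psi / Xi nu a g)) = fun=> 0.
    by apply/funext => g; rewrite orth mul0r mulr0.
  by rewrite /cintegral /Rintegral !integral0 mulr0.
move=> h; apply/esym; exact: (cvg_unique _ (@cvg_cst _ _ _ _ _) h).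
Qed.

End ergodic.

Theorem proposition2p8 (R : realType)
    (G : topologicalGroupType) (mu : {measure set (Borel G) -> \bar R})
    (B : ptopologicalType) (nu : probability (Borel B) R)
    (a : continuous_action G B)
    (G_lc : locally_compact [set: G]) (G_sc : @second_countable G)
    (mu_haar : left_haar_measure mu)
    (B_sc : @second_countable B)
    (nu_qi : quasi_invariant nu a)
    (nu_bd : locally_bounded_density nu a)
    (F : set (Borel B -> R[i]))
    (F_bdd : forall f, F f -> bounded_borel f)
    (F_dense : dense_in_L2 nu F)
    (F_one : F (@one_B R B))
    (F_erg : forall f, F f ->
       exists (E : nat -> set (Borel G)) (e : nat -> Borel G -> Borel B),
         averaging_data mu E e /\ ergodic_relative nu a mu E e f) :
  irreducible nu (quasi_regular nu a).
Proof.
move=> V Vc Vinv; have [VL2 _ _ _] := Vc.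
have [orth1|/existsNP[phi /not_implyP[Vphi /eqP phi1]]] :=
    pselect (forall phi, V phi -> inner nu phi (@one_B R B) = 0).
  left; apply/seteqP; split; last exact: zero_L2_sub.
  move=> psi Vpsi; have Lpsi := VL2 _ Vpsi; split => //.
  apply/nsq_eq0; first by case: Lpsi.
  apply: (nsq_orth_dense F_dense Lpsi) => f /F_erg[E [e [_ erg]]].
  apply: (ergodic_orthogonal erg (L2_one nu) Lpsi).
    (* Invariance puts the translate of [psi] in [V], which gives both its square-integrability and
       its orthogonality to 1. *)
    move=> g; have Vg := Vinv g^-1%g _ Vpsi.
    rewrite inner_quasi_regular_one ?orth1 ?conjc0//; exact: VL2.
  by rewrite inner_one_one oner_neq0.
right; apply/seteqP; split => // f Lf.
have [v Vv orth] := L2_projection Vc Lf.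
have Lfv := L2B Lf (VL2 _ Vv).
(* It suffices that [f] equals its projection [v] almost everywhere, i.e. that the residual [f - v]
   has norm zero. *)
apply: (closed_subspace_nsq0 Vc Lf Vv).
apply: (nsq_orth_dense F_dense Lfv) => h /F_erg[E [e [_ erg]]].
apply: (ergodic_orthogonal erg (VL2 _ Vphi) Lfv _ phi1) => g.
exact/orth/Vinv.
Qed.
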